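(* For every $\varepsilon \in (0,1/2)$ there exists a growth function $\mathcal{F}$ depending only on $\varepsilon$ such that the following holds. Let $G$ be a finite abelian group and let $A\subset G$ be a subset. Then there exists a subset $A'\subset G$ which is $1$-measurable with growth $\mathcal{F}$ such that $$|A\setminus A'| \leq \varepsilon |G| \quad\text{and}\quad |S_{\varepsilon}(A') \setminus (A+A)| \leq \varepsilon |G|.$$
   Context: Let $G$ be a finite abelian group, written additively; $\mathbb{E}_{x\in G}$ denotes the average over $G$. For $A\subset G$ and $\varepsilon>0$, $A+A=\{a+b:a,b\in A\}$, $x-A=\{x-a:a\in A\}$, and the set of $\varepsilon$-popular sums is $$S_{\varepsilon}(A) = \{x\in G : |A\cap(x-A)|\ge \varepsilon|G|\}.$$ A character is a homomorphism $\gamma: G\to\mathbb{R}/\mathbb{Z}$; $\widehat{G}$ is the group of characters; $e(y)=e^{2\pi i y}$. For $f:G\to\mathbb{C}$, $\widehat{f}(\gamma) = \mathbb{E}_{x\in G} f(x)e(-\gamma(x))$, $\|f\|_2^2=\mathbb{E}_{x\in G}|f(x)|^2$, $\|\widehat{f}\|_1=\sum_{\gamma\in\widehat{G}}|\widehat{f}(\gamma)|$. $f$ is $1$-bounded if $\|f\|_\infty\le 1$. A growth function is an increasing (in the weak sense) function $\mathcal{F}:\mathbb{R}_{>0}\to\mathbb{R}_{>0}$. A $1$-bounded $f:G\to\mathbb{C}$ is $1$-measurable with growth $\mathcal{F}$ if for every $M>0$ there is a $1$-bounded $f_{\mathrm{str}}:G\to\mathbb{C}$ with $\|\widehat{f_{\mathrm{str}}}\|_1\le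 \mathcal{F}(M)$ and $\|f-f_{\mathrm{str}}\|_2\le M^{-1}$. A subset $E\subset G$ is $1$-measurable with growth $\mathcal{F}$ if its indicator function $1_E$ is. *)

(* Defs.v *)
From HB Require Import structures.
From mathcomp Require Import all_boot all_order all_algebra.
From mathcomp Require Import ring_quotient complex.
From mathcomp Require Import boolp classical_sets cardinality fsbigop.
From mathcomp Require Import reals trigo.

Set Implicit Arguments.
Unset Strict Implicit.
Unset Printing Implicit Defensive.

Import Order.TTheory GRing.Theory Num.Theory.

Local Open Scope ring_scope.
Local Open Scope quotient_scope.

Definition ints (R : realType) : zmodClosed R :=
  GRing.ZmodClosed.clone R (@Num.int_num_subdef R) _.

(* The additive group R/Z. *)
Notation circle R := (Quotient.quot (ints R)).

(* The modulus as an element of R; the norm of R[i] itself is R[i]-valued. *)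
Notation cmod := Normc.normc.

Section Defs.
Variable R : realType.
Implicit Types (F : R -> R) (eps : R).

(* e(y) = exp(2 i pi y), computed on a representative of the class in R/Z;
   by ecircle_pi the choice of representative is irrelevant. *)
Definition ecircle (t : circle R) : R[i] :=
  Complex (cos (2 * pi * repr t)) (sin (2 * pi * repr t)).

Lemma ecircle_pi (y : R) :
  ecircle (\pi_(circle R) y) = Complex (cos (2 * pi * y)) (sin (2 * pi * y)).
Proof.
have periodz (f : R -> R) a (m : int) :
    periodic f (pi *+ 2) -> f (2 * pi * (a + m%:~R)) = f (2 * pi * a).
  move=> pf; rewrite mulrDr; case: m => n.
    by rewrite -pmulrn mulr_natr mulr_natl periodicn.
  rewrite NegzE mulrNz mulrN -pmulrn mulr_natr.
  by rewrite -[LHS](periodicn pf n.+1) mulr_natl subrK.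
have /eqP := reprK (\pi_(circle R) y).
rewrite -Quotient.idealrBE => /intrP[m] /eqP.
rewrite subr_eq addrC => /eqP rE; rewrite /ecircle rE.
by rewrite !periodz //; [exact: sinD2pi | exact: cosD2pi].
Qed.

Definition growth_function F : Prop :=
  (forall x, 0 < x -> 0 < F x) /\
  (forall x y, 0 < x -> x <= y -> F x <= F y).

Variable G : finZmodType.
Implicit Types (f : G -> R[i]) (A B : {set G}).

Definition characters : set (G -> circle R) :=
  [set g : G -> circle R | {morph g : x y / x + y}]%classic.

Lemma finite_characters : finite_set characters.
Proof.
pose N := #|G|.
have N_gt0 : (0 < N)%N by apply/card_gt0P; exists 0.
have NR0 : N%:R != 0 :> R by rewrite pnatr_eq0 -lt0n.
have torsion (x : G) : x *+ N = 0.
  apply: (addrI (\sum_(y : G) y)); rewrite addr0.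
  rewrite -sumr_const -big_split /=.
  by rewrite [RHS](reindex_inj (addIr x)).
pose h (u : {ffun G -> 'I_N}) (x : G) : circle R :=
  \pi_(circle R) ((u x : nat)%:R / N%:R).
apply: (@sub_finite_set _ _ [set h u | u in [set: {ffun G -> 'I_N}]]%classic).
  move=> g gD.
  have g0 : g 0 = 0 by apply: (addIr (g 0)); rewrite -gD !add0r.
  have gMn x n : g (x *+ n) = g x *+ n.
    by elim: n => [|n IHn]; rewrite ?mulr0n // !mulrS gD IHn.
  have coord x : exists k : 'I_N, \pi_(circle R) ((k : nat)%:R / N%:R) = g x.
    have : \pi_(circle R) (repr (g x) *+ N) = \pi_(circle R) 0.
      by rewrite !raddfMn /= reprK -gMn torsion g0 raddf0.
    move=> /eqP; rewrite -Quotient.idealrBE subr0 => /intrP[m rm].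
    have Nz0 : N%:Z != 0 by rewrite eqz_nat -lt0n.
    have kN : (`|(m %% N)%Z| < N)%N.
      by rewrite -ltz_nat gez0_abs ?modz_ge0 // ltz_pmod.
    exists (Ordinal kN); rewrite /= -[RHS]reprK; apply/eqP.
    rewrite -Quotient.idealrBE; apply/intrP; exists (- (m %/ N)%Z).
    apply: (mulIf NR0); rewrite mulrBl divfK // mulr_natr rm.
    rewrite {2}(divz_eq m N) intrD intrM -[_%:R]/((_%:Z)%:~R).
    by rewrite gez0_abs ?modz_ge0 // mulrNz mulNr opprD addrCA subrr addr0.
  exists [ffun x => projT1 (cid (coord x))] => //=.
  by apply/funext => x; rewrite /h ffunE; case: cid.
exact: finite_image.
Qed.

Definition expect f : R[i] := (\sum_x f x) / #|G|%:R.

Definition fourier f (g : G -> circle R) : R[i] :=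
  expect (fun x => f x * ecircle (- g x)).

Definition norm2 f : R := Num.sqrt ((\sum_x cmod (f x) ^+ 2) / #|G|%:R).

(* A sum over a finite index set, by finite_characters. *)
Definition fourier_norm1 f : R := \sum_(g \in characters) cmod (fourier f g).

Definition one_bounded f : Prop := forall x, cmod (f x) <= 1.

Definition measurable1 F f : Prop :=
  one_bounded f /\
  forall M : R, 0 < M -> exists fstr : G -> R[i],
    [/\ one_bounded fstr, fourier_norm1 fstr <= F M & norm2 (fun x => f x - fstr x) <= M^-1].

Definition indicator A (x : G) : R[i] := (x \in A)%:R.

Definition set_measurable1 F A : Prop := measurable1 F (indicator A).

Definition sumset A B : {set G} := [set a + b | a in A, b in B].

Definition popular_sums eps A : {set G} :=
  [set x | eps * #|G|%:R <= #|A :&: [set x - a | a in A]|%:R].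

End Defs.

(* Main.v *)
Require Import Defs.
From mathcomp Require Import all_boot all_order all_algebra.
From mathcomp Require Import fingroup algC cyclotomic classfun character.
From mathcomp Require Import generic_quotient complex finmap.
From mathcomp Require Import boolp classical_sets cardinality fsbigop.
From mathcomp Require Import reals trigo.
From mathcomp Require Import ring lra.

(* Let f = 1_A and let g keep only the Fourier coefficients of f of size at
   least eta_i, where the decreasing thresholds eta_0 > eta_1 > ... depend only
   on eps and, by pigeonhole, i is bounded and the coefficients of size between
   eta_{i+1} and eta_i have negligible total energy. Then f - g is almost
   orthogonal to psi(g) for every fixed piecewise linear psi: psi(g) is
   uniformly close to a polynomial in g, whose Wiener norm is controlled by
   1/eta_i and beaten by the choice of eta_{i+1}. Hence g is nearly nonnegative,
   and f has little mass where g < t, for some threshold t in [eps/4, eps/2].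
   Set A' = {g >= t}. As 1_A' <= (4/eps) g_+, every eps-popular sum of A' has
   g * g bounded below, while f * f vanishes outside A + A and f * f - g * g is
   small in L^2 because f - g has small Fourier coefficients. Finally t is
   chosen by repeated halving so that |g - t| is small on few points only at
   every scale simultaneously; a piecewise linear approximation of the step at
   t, then a polynomial one, shows that A' is 1-measurable. *)

Set Implicit Arguments.
Unset Strict Implicit.
Unset Printing Implicit Defensive.

Import Order.TTheory GRing.Theory Num.Theory.

Local Open Scope ring_scope.
Local Open Scope quotient_scope.
Local Open Scope complex_scope.
(* In the arguments of ring operations ring_scope takes precedence, where ^* is
   Num.conj. *)
Local Notation "z ^*" := (conjc z) : ring_scope.

(** * Characters *)

Section Ecircle.
Variable R : realType.
Implicit Types s t : circle R.

Lemma ecircleD s t : ecircle (s + t) = ecircle s * ecircle t.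
Proof.
rewrite -[s]reprK -[t]reprK -raddfD !ecircle_pi mulrDr cosD sinD.
by apply/eqP; rewrite eq_complex /=; apply/andP; split; apply/eqP; ring.
Qed.

Lemma ecircle0 : ecircle (0 : circle R) = 1.
Proof. by rewrite -(raddf0 (\pi_(circle R))) ecircle_pi mulr0 cos0 sin0. Qed.

Lemma ecircleN t : ecircle (- t) = (ecircle t)^*.
Proof. by rewrite -[t]reprK -raddfN !ecircle_pi mulrN cosN sinN. Qed.

Lemma cmod_ecircle t : cmod (ecircle t) = 1.
Proof. by rewrite /ecircle /= cos2Dsin2 sqrtr1. Qed.

(** With [z] the fractional part of a representative, [cos (2 * pi * z) = 1] forces
    [sin (pi * z) = 0], while the sine is positive inside (0, pi). *)
Lemma ecircle_eq1 t : ecircle t = 1 -> t = 0.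
Proof.
rewrite -[t]reprK; set y := repr t; rewrite ecircle_pi => -[cE _].
have E : y = (y - (Num.floor y)%:~R) + (Num.floor y)%:~R by rewrite subrK.
set z := y - _ in E.
have z0 : 0 <= z by rewrite subr_ge0 floor_le.
have z1 : z < 1 by rewrite ltrBlDl; have := floorD1_gt y; rewrite intrD.
have: cos (2 * pi * z) = cos (2 * pi * y).
  have := ecircle_pi z; have := ecircle_pi y.
  have -> : \pi_(circle R) y = \pi_(circle R) z; last by move=> -> [-> _].
  apply/eqP; rewrite -Quotient.idealrBE {1}E addrAC subrr add0r.
  by apply/intrP; exists (Num.floor y).
have -> : 2 * pi * z = (pi * z) *+ 2 by ring.
rewrite cE cos_mulr2n => c2.
have s0 : sin (pi * z) = 0.
  have := cos2Dsin2 (pi * z) => cs.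
  by apply/eqP; rewrite -sqrf_eq0; apply/eqP; move: c2 cs; rewrite mulr2n; lra.
have zz : z = 0.
  apply/eqP; case: ltgtP z0 => // z_gt0 _.
  have := @sin_gt0_pi R (pi * z); rewrite s0 ltxx => /(_ _)->//.
  by rewrite mulr_gt0 ?pi_gt0 //= gtr_pMr ?pi_gt0.
apply/eqP; rewrite -(raddf0 (\pi_(circle R))) -Quotient.idealrBE subr0.
by rewrite E zz add0r; apply/intrP; exists (Num.floor y).
Qed.

End Ecircle.

Lemma finZmod_torsion (G : finZmodType) (x : G) : x *+ #|G| = 0.
Proof.
apply: (addrI (\sum_(y : G) y)); rewrite addr0 -sumr_const -big_split /=.
by rewrite [RHS](reindex_inj (addIr x)).
Qed.

(* The irreducible characters of an abelian group are linear, with values in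
   the powers of a primitive root of unity z, and separate points; the
   exponents of z are turned into elements of R/Z. *)
Lemma characters_separate (R : realType) (G : finZmodType) (x : G) :
  x != 0 -> exists2 g : G -> circle R, characters g & g x != 0.
Proof.
move=> x0; pose N := #|G|.
have N_gt0 : (0 < N)%N by apply/card_gt0P; exists 0.
have [i chi1] : exists i : Iirr [set: G], 'chi_i x != 'chi_i 1%g.
  apply/existsP; apply: contraNT x0; rewrite negb_exists => /forallP H.
  suff : x \in [1 G]%g by rewrite inE.
  rewrite -(TI_cfker_irr [set: G]%G); apply/bigcapP => i _.
  by rewrite cfkerEirr inE; have := H i; rewrite negbK.
have lin : 'chi_i \is a linear_char.
  by move: i {chi1}; apply/char_abelianP; exact: FinRing.zmod_abelian.
have [z pz] := C_prim_root_exists N_gt0.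
have unity y : 'chi_i y ^+ N = 1.
  rewrite -lin_charX ?inE // FinRing.zmodXgE finZmod_torsion.
  by rewrite -FinRing.zmod1gE lin_char1.
pose k y := sval (prim_rootP pz (unity y)).
have kE y : 'chi_i y = z ^+ k y by rewrite /k; case: prim_rootP.
have NR0 : N%:R != 0 :> R by rewrite pnatr_eq0 -lt0n.
have piE (a b : nat) : (\pi_(circle R) (a%:R / N%:R) == \pi_(circle R) (b%:R / N%:R)) =
    (a == b %[mod N])%N.
  rewrite -Quotient.idealrBE -mulrBl -eqz_nat -!modz_nat eqz_mod_dvd.
  apply/intrP/dvdzP => -[m E]; exists m.
    apply/eqP; rewrite -(eqr_int R) intrB intrM.
    by rewrite -[a%:~R]/(a%:R) -[b%:~R]/(b%:R) -[N%:~R]/(N%:R) -E divfK.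
  rewrite -[a%:R]/(a%:~R) -[b%:R]/(b%:~R) -intrB E intrM.
  by rewrite -[N%:~R]/(N%:R) mulfK.
exists (fun y => \pi_(circle R) ((k y)%:R / N%:R)).
  move=> a b /=; rewrite -raddfD -mulrDl -natrD; apply/eqP; rewrite piE.
  rewrite -(eq_prim_root_expr pz) exprD -!kE -lin_charM ?inE //.
have := piE (k x) 0%N; rewrite mul0r raddf0 => ->.
by rewrite -(eq_prim_root_expr pz) -kE expr0 -(lin_char1 lin).
Qed.

Arguments conjc : simpl never.

Lemma conjcM (R : realType) (x y : R[i]) : (x * y)^* = x^* * y^*.
Proof. exact: rmorphM. Qed.

Section Dual.
Variables (R : realType) (G : finZmodType).

(** The characters as a finite type, so that sums over them are ordinary big operators;
    [finite_characters] gives [fset_set] its meaning. *)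
Definition dual : finType := fset_set (@characters R G).

Definition chi (d : dual) (x : G) : R[i] := ecircle (val d x).

#[global] Arguments chi : simpl never.


Lemma characters_dual (g : G -> circle R) :
  characters g -> exists d : dual, forall x, chi d x = ecircle (g x).
Proof.
move=> gD; have gin : g \in fset_set (@characters R G).
  by rewrite in_fset_set ?inE //; exact: finite_characters.
by exists [` gin]%fset.
Qed.

Lemma dual_characters (d : dual) : characters (val d).
Proof.
have := valP d; rewrite in_fset_set ?inE //; exact: finite_characters.
Qed.

Lemma chiD d x y : chi d (x + y) = chi d x * chi d y.
Proof. by rewrite /chi (dual_characters d) ecircleD. Qed.

Lemma chi0 d : chi d 0 = 1.
Proof.
rewrite /chi; have : val d 0 + val d 0 = val d 0 + 0.
  by rewrite -(dual_characters d) !addr0.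
by move/addrI ->; rewrite ecircle0.
Qed.

Lemma cmod_chi d x : cmod (chi d x) = 1.
Proof. exact: cmod_ecircle. Qed.

Lemma chi_conjK d x : chi d x * (chi d x)^* = 1.
Proof. by rewrite /chi -ecircleN -ecircleD subrr ecircle0. Qed.

Lemma chiN d x : chi d (- x) = (chi d x)^*.
Proof.
have : chi d x * chi d (- x) = chi d x * (chi d x)^*.
  by rewrite -chiD subrr chi0 chi_conjK.
apply: mulfI; apply: contra_eq_neq (chi_conjK d x) => ->.
by rewrite mul0r eq_sym oner_eq0.
Qed.

(** No group structure is put on [dual]: adding a fixed character and negating serve as injections
    for reindexing sums. *)
Lemma dual_add_ex (d d' : dual) :
  {k : dual | forall x, val k x = val d x + val d' x}.
Proof.
apply: cid; have gin : (fun x => val d x + val d' x) \in fset_set (@characters R G).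
  rewrite in_fset_set ?inE; last exact: finite_characters.
  by move=> x y /=; rewrite !dual_characters addrACA.
by exists [` gin]%fset.
Qed.

Definition dual_add d d' : dual := sval (dual_add_ex d d').

Lemma chi_dual_add d d' x : chi (dual_add d d') x = chi d x * chi d' x.
Proof. by rewrite /chi /dual_add; case: dual_add_ex => k /= ->; rewrite ecircleD. Qed.

Lemma dual_addI d : injective (dual_add d).
Proof.
move=> a b; rewrite /dual_add; case: dual_add_ex => k kE; case: dual_add_ex => l lE /= kl.
by apply/val_inj/funext => x; apply: (addrI (val d x)); rewrite -kE -lE kl.
Qed.

Lemma dual_opp_ex (d : dual) : {k : dual | forall x, val k x = - val d x}.
Proof.
apply: cid; have gin : (fun x => - val d x) \in fset_set (@characters R G).
  rewrite in_fset_set ?inE; last exact: finite_characters.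
  by move=> x y /=; rewrite !dual_characters opprD.
by exists [` gin]%fset.
Qed.

Definition dual_opp d : dual := sval (dual_opp_ex d).

Lemma chi_dual_opp d x : chi (dual_opp d) x = (chi d x)^*.
Proof. by rewrite /chi /dual_opp; case: dual_opp_ex => k /= ->; rewrite ecircleN. Qed.

Lemma dual_oppI : injective dual_opp.
Proof.
move=> a b; rewrite /dual_opp; case: dual_opp_ex => k kE; case: dual_opp_ex => l lE /= kl.
by apply/val_inj/funext => x; apply: oppr_inj; rewrite -kE -lE kl.
Qed.

Lemma cardG_neq0 (F : numDomainType) : #|G|%:R != 0 :> F.
Proof. by rewrite pnatr_eq0 -lt0n; apply/card_gt0P; exists 0. Qed.

(** If the characters differ, shifting [x] by a suitable [y] multiplies the sum by some [c] other
    than 1, because [ecircle] takes the value 1 only at 0. *)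
Lemma sum_chi d d' : \sum_x chi d x * (chi d' x)^* = #|G|%:R * (d == d')%:R.
Proof.
case: eqVneq => [->|dd']; last first.
  rewrite mulr0.
  have [y dy] : exists y, val d y != val d' y.
    apply/existsP; apply: contraNT dd'; rewrite negb_exists => /forallP H.
    by apply/eqP/val_inj/funext => y; apply/eqP; have := H y; rewrite negbK.
  set S := \sum_x _; set c := chi d y * (chi d' y)^*.
  have c1 : c != 1.
    apply: contraNneq dy; rewrite /c /chi -ecircleN -ecircleD => /ecircle_eq1/eqP.
    by rewrite subr_eq0.
  have /eqP: c * S = S.
    rewrite {2}/S (reindex_inj (addrI y)) mulr_sumr; apply: eq_bigr => x _.
    by rewrite !chiD conjcM /c; ring.
  by rewrite -subr_eq0 -{2}[S]mul1r -mulrBl mulf_eq0 subr_eq0 (negPf c1) => /eqP.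
rewrite mulr1 (eq_bigr (fun=> 1)) => [|x _]; last exact: chi_conjK.
by rewrite sumr_const.
Qed.

(** The same invariance in the dual variable, with a character that separates [x] from 0. *)
Lemma sum_dual_chi x : \sum_d chi d x = #|dual|%:R * (x == 0)%:R.
Proof.
case: eqVneq => [->|x0]; last first.
  have [g /characters_dual[d0 gE] gx] := characters_separate R x0.
  rewrite mulr0; set S := \sum_d _.
  have c1 : chi d0 x != 1.
    by rewrite gE; apply: contraNneq gx => /ecircle_eq1 ->.
  have /eqP: chi d0 x * S = S.
    rewrite {2}/S (reindex_inj (@dual_addI d0)) mulr_sumr; apply: eq_bigr => d _.
    by rewrite chi_dual_add.
  by rewrite -subr_eq0 -{2}[S]mul1r -mulrBl mulf_eq0 subr_eq0 (negPf c1) => /eqP.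
rewrite mulr1 (eq_bigr (fun=> 1)) => [|d _]; last exact: chi0.
by rewrite sumr_const.
Qed.

(** Summing [chi d x] over all pairs, first over [d] or first over [x], gives the two
    cardinalities. *)
Lemma card_dual : #|dual| = #|G|.
Proof.
have [d0 d0E] := @characters_dual (fun=> 0) (fun x y => esym (addr0 0)).
apply/eqP; rewrite -(eqr_nat R[i]); apply/eqP.
transitivity (\sum_x \sum_d chi d x).
  rewrite (eq_bigr _ (fun x _ => sum_dual_chi x)) -mulr_sumr (bigD1 0) //=.
  by rewrite eqxx big1 ?addr0 ?mulr1 // => x /negPf->.
rewrite exchange_big (bigD1 d0) //= [X in _ + X]big1 ?addr0 => [|d dd].
  by rewrite (eq_bigr (fun=> 1)) ?sumr_const // => x _; rewrite d0E ecircle0.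
transitivity (\sum_x chi d x * (chi d0 x)^*); last by rewrite sum_chi (negPf dd) mulr0.
by apply: eq_bigr => x _; rewrite d0E ecircle0 conjc1 mulr1.
Qed.

End Dual.

(** * Fourier analysis and the Wiener norm *)

Section Fourier.
Variables (R : realType) (G : finZmodType).
Local Notation dual := (dual R G).
Implicit Types (f g u v : G -> R) (d : dual).

Definition avg f : R := (\sum_x f x) / #|G|%:R.

(** The functions analysed below are real; [fcoefE] and [wienerE] make the link with [fourier] and
    [fourier_norm1]. *)
Definition fcoef f d : R[i] := (\sum_x (f x)%:C * (chi d x)^*) / #|G|%:R.

Definition wiener f : R := \sum_d cmod (fcoef f d).

Lemma fcoefE f d : fcoef f d = fourier (fun x => (f x)%:C) (val d).
Proof.
by rewrite /fourier /expect; congr (_ / _); apply: eq_bigr => x _; rewrite ecircleN.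
Qed.

Lemma wienerE f : fourier_norm1 (fun x => (f x)%:C) = wiener f.
Proof.
rewrite /fourier_norm1 fsbig_finite /=; last exact: finite_characters.
by rewrite big_seq_fsetE /=; apply: eq_bigr => d _; rewrite fcoefE.
Qed.

Lemma fourier_inv f x : (f x)%:C = \sum_d fcoef f d * chi d x.
Proof.
rewrite /fcoef; under eq_bigr do rewrite -mulrA mulrCA mulr_suml.
rewrite -mulr_sumr exchange_big /=.
under eq_bigr => y _.
  under eq_bigr do rewrite -mulrA -chiN -chiD.
  rewrite -mulr_sumr sum_dual_chi card_dual.
  over.
rewrite (bigD1 x) //= big1 ?addr0 => [|y yx].
  by rewrite addNr eqxx mulr1 mulrCA mulVf ?mulr1 ?cardG_neq0.
by rewrite addrC subr_eq0 eq_sym (negPf yx) !mulr0.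
Qed.

Lemma sqr_cmod (z : R[i]) : (cmod z ^+ 2)%:C = z * z^*.
Proof.
rewrite rmorphXn /= -[(cmod z)%:C]/`|z| -add_Re2_Im2; case: z => a b /=.
by apply/eqP; rewrite eq_complex /=; apply/andP; split; apply/eqP; ring.
Qed.

Lemma parseval2 f g :
  \sum_d fcoef f d * (fcoef g d)^* = ((\sum_x f x * g x) / #|G|%:R)%:C.
Proof.
transitivity (\sum_d (\sum_x (g x)%:C * (fcoef f d * chi d x)) / #|G|%:R).
  apply: eq_bigr => d _; rewrite {2}/fcoef rmorphM fmorphV rmorph_nat mulrA.
  congr (_ / _); rewrite rmorph_sum mulr_sumr; apply: eq_bigr => x _.
  by rewrite [X in _ * X](conjcM (g x)%:C) conjcK conjc_real mulrCA.
rewrite -mulr_suml rmorphM fmorphV rmorph_nat; congr (_ / _).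
rewrite exchange_big rmorph_sum; apply: eq_bigr => x _ /=.
by rewrite -mulr_sumr -fourier_inv rmorphM mulrC.
Qed.

Lemma parseval f : \sum_d cmod (fcoef f d) ^+ 2 = avg (fun x => f x ^+ 2).
Proof.
apply: complexI; rewrite rmorph_sum -(parseval2 f f).
by apply: eq_bigr => d _; exact: sqr_cmod.
Qed.

Lemma cmod_real (r : R) : cmod r%:C = `|r|.
Proof. by rewrite /= expr0n /= addr0 sqrtr_sqr. Qed.

Lemma cmod_ge0 (z : R[i]) : 0 <= cmod z.
Proof. by case: z => a b; exact: sqrtr_ge0. Qed.

Lemma cmodJ (z : R[i]) : cmod z^* = cmod z.
Proof. by case: z => a b /=; rewrite sqrrN. Qed.

Lemma cmod_sum (I : Type) (r : seq I) (F : I -> R[i]) :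
  cmod (\sum_(i <- r) F i) <= \sum_(i <- r) cmod (F i).
Proof.
elim/big_rec2: _ => [|i b a _ H]; first by rewrite (cmod_real 0) normr0.
by apply: (le_trans (le_normcD _ _)); rewrite lerD2l.
Qed.

Lemma wiener_ge0 f : 0 <= wiener f.
Proof. by apply: sumr_ge0 => d _; exact: cmod_ge0. Qed.

Lemma sup_le_wiener f x : `|f x| <= wiener f.
Proof.
rewrite -cmod_real fourier_inv; apply: (le_trans (cmod_sum _ _)).
by apply: ler_sum => d _; rewrite Normc.normcM cmod_chi mulr1.
Qed.

(** Parseval turns the average into a pairing of an l^infinity bound with an l^1 norm: a function
    with small Fourier coefficients is almost orthogonal to every function of bounded Wiener
    norm. *)
Lemma avg_pairing (u v : G -> R) (eta : R) :
  (forall d, cmod (fcoef u d) <= eta) ->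
  `|avg (fun x => u x * v x)| <= eta * wiener v.
Proof.
move=> ueta; rewrite -cmod_real -parseval2; apply: (le_trans (cmod_sum _ _)).
rewrite mulr_sumr; apply: ler_sum => d _; rewrite Normc.normcM cmodJ.
by rewrite ler_wpM2r ?cmod_ge0.
Qed.

Lemma fcoefD f g d : fcoef (fun x => f x + g x) d = fcoef f d + fcoef g d.
Proof.
rewrite /fcoef -mulrDl -big_split; congr (_ / _); apply: eq_bigr => x _ /=.
by rewrite rmorphD mulrDl.
Qed.

Lemma fcoefZ (a : R) f d : fcoef (fun x => a * f x) d = a%:C * fcoef f d.
Proof.
rewrite /fcoef mulrA mulr_sumr; congr (_ / _); apply: eq_bigr => x _ /=.
by rewrite rmorphM mulrA.
Qed.

Lemma fcoefB f g d : fcoef (fun x => f x - g x) d = fcoef f d - fcoef g d.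
Proof.
rewrite /fcoef -mulrBl -sumrB; congr (_ / _); apply: eq_bigr => x _ /=.
by rewrite rmorphB mulrBl.
Qed.

Lemma wienerD f g : wiener (fun x => f x + g x) <= wiener f + wiener g.
Proof.
rewrite -big_split; apply: ler_sum => d _ /=; rewrite fcoefD; exact: le_normcD.
Qed.

Lemma wienerZ (a : R) f : wiener (fun x => a * f x) = `|a| * wiener f.
Proof.
by rewrite mulr_sumr; apply: eq_bigr => d _; rewrite fcoefZ Normc.normcM cmod_real.
Qed.

Lemma wiener_cst (a : R) : wiener (fun=> a) = `|a|.
Proof.
have [d0 d0E] := @characters_dual R G (fun=> 0) (fun x y => esym (addr0 0)).
have cE d : fcoef (fun=> a) d = a%:C * (d0 == d)%:R.
  rewrite /fcoef -mulr_sumr -mulrA; congr (_ * _).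
  rewrite (eq_bigr (fun x => chi d0 x * (chi d x)^*)) => [|x _].
    by rewrite sum_chi mulrC mulrA mulVf ?cardG_neq0 ?mul1r.
  by rewrite d0E ecircle0 mul1r.
rewrite /wiener (bigD1 d0) //= big1 ?addr0 => [|d dd].
  by rewrite cE eqxx mulr1 cmod_real.
by rewrite cE eq_sym (negPf dd) mulr0 (cmod_real 0) normr0.
Qed.

(** The transform of a product is the convolution of the transforms, and the l^1 norm is
    submultiplicative for convolution. *)
Lemma wienerM f g : wiener (fun x => f x * g x) <= wiener f * wiener g.
Proof.
have cE d : fcoef (fun x => f x * g x) d =
    \sum_d' fcoef f d' * fcoef g (dual_add (dual_opp d') d).
  rewrite {1}/fcoef; under eq_bigr do rewrite rmorphM /= fourier_inv !mulr_suml.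
  rewrite exchange_big mulr_suml; apply: eq_bigr => d' _ /=.
  rewrite /fcoef [RHS]mulrA; congr (_ / _); rewrite mulr_sumr; apply: eq_bigr => x _.
  by rewrite chi_dual_add chi_dual_opp conjcM conjcK; ring.
apply: (@le_trans _ _ (\sum_d \sum_d' cmod (fcoef f d') *
    cmod (fcoef g (dual_add (dual_opp d') d)))).
  apply: ler_sum => d _; rewrite cE; apply: (le_trans (cmod_sum _ _)).
  by apply: ler_sum => d' _; rewrite Normc.normcM.
rewrite exchange_big mulr_suml; apply: ler_sum => d' _ /=.
by rewrite -mulr_sumr [wiener g](reindex_inj (@dual_addI _ _ (dual_opp d'))).
Qed.

Definition conv u v (x : G) : R := avg (fun y => u y * v (x - y)).

Lemma fcoef_conv u v d : fcoef (conv u v) d = fcoef u d * fcoef v d.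
Proof.
have N0 := @cardG_neq0 G R[i].
rewrite {1}/fcoef.
transitivity (\sum_x \sum_y ((u y)%:C * (chi d y)^* * ((v (x - y))%:C * (chi d (x - y))^*))
   / #|G|%:R / #|G|%:R).
  rewrite mulr_suml; apply: eq_bigr => x _.
  rewrite /conv /avg rmorphM fmorphV rmorph_nat rmorph_sum !mulr_suml.
  apply: eq_bigr => y _; rewrite rmorphM /= -{2}[x](subrK y) chiD conjcM; ring.
rewrite exchange_big /= [in RHS]/fcoef mulrA mulr_suml mulr_suml mulr_suml.
apply: eq_bigr => y _; rewrite (reindex_inj (addIr y)) /= -!mulr_suml -mulr_sumr.
rewrite (eq_bigr (fun x => (v x)%:C * (chi d x)^*)) => [|x _]; last by rewrite addrK.
ring.
Qed.

(** Convolution multiplies the transforms, so the bound on the coefficients of [u] factors out of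
    the Parseval sum. *)
Lemma avg_conv_sqr u v (eta : R) : (forall d, cmod (fcoef u d) <= eta) ->
  avg (fun x => conv u v x ^+ 2) <= eta ^+ 2 * avg (fun x => v x ^+ 2).
Proof.
move=> ueta; rewrite -!parseval mulr_sumr; apply: ler_sum => d _.
rewrite fcoef_conv Normc.normcM exprMn ler_wpM2r ?sqr_ge0 //.
by rewrite lerXn2r ?nnegrE ?cmod_ge0 // (le_trans (cmod_ge0 _) (ueta d)).
Qed.

End Fourier.

(** * Averages over the group *)

Section Averages.
Variables (R : realType) (G : finZmodType).
Implicit Types (f g u v : G -> R).

Lemma avgD f g : avg (fun x => f x + g x) = avg f + avg g.
Proof. by rewrite /avg big_split mulrDl. Qed.

Lemma avgZ (a : R) f : avg (fun x => a * f x) = a * avg f.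
Proof. by rewrite /avg -mulr_sumr mulrA. Qed.

Lemma ler_avg f g : (forall x, f x <= g x) -> avg f <= avg g.
Proof. by move=> fg; rewrite ler_wpM2r ?invr_ge0 ?ler_sum. Qed.

Lemma avg_cst (a : R) : avg (fun _ : G => a) = a.
Proof. by rewrite /avg sumr_const -[a *+ _]mulr_natr mulfK ?cardG_neq0. Qed.

Lemma avg_ge0 f : (forall x, 0 <= f x) -> 0 <= avg f.
Proof. by move=> f0; rewrite -(avg_cst 0) ler_avg. Qed.

Lemma avg_abs f : `|avg f| <= avg (fun x => `|f x|).
Proof.
rewrite /avg normrM (ger0_norm (_ : 0 <= _^-1)) ?invr_ge0 //.
by rewrite ler_wpM2r ?invr_ge0 ?ler_norm_sum.
Qed.

Lemma avg_cauchy_schwarz f g :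
  avg (fun x => f x * g x) ^+ 2 <= avg (fun x => f x ^+ 2) * avg (fun x => g x ^+ 2).
Proof.
set A := avg (fun x => f x ^+ 2); set B := avg (fun x => g x ^+ 2); set C := avg _.
have H (s t : R) : 0 <= s ^+ 2 * A - 2 * s * t * C + t ^+ 2 * B.
  have -> : s ^+ 2 * A - 2 * s * t * C + t ^+ 2 * B = avg (fun x =>
      s ^+ 2 * f x ^+ 2 + - (2 * s * t) * (f x * g x) + t ^+ 2 * g x ^+ 2).
    by rewrite !avgD !avgZ mulNr.
  apply: avg_ge0 => x; rewrite [X in 0 <= X](_ : _ = (s * f x - t * g x) ^+ 2) ?sqr_ge0 //; ring.
have A0 : 0 <= A by have := H 1 0; lra.
(* The first instance equals [A * (A * B - C ^+ 2)] and settles [A > 0]; when [A = 0] the second one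
   equals [- (2 + B) * C ^+ 2] and forces [C = 0]. *)
have := H C A; have := H (1 + B) C.
have B0 : 0 <= B by have := H 0 1; lra.
have [->|A_gt0] := eqVneq A 0; first by move=> + _; have := sqr_ge0 C; nra.
move=> _ H1; have {}A_gt0 : 0 < A by rewrite lt_def A_gt0.
have : 0 <= A * (A * B - C ^+ 2) by move: H1; nra.
by rewrite pmulr_rge0 // subr_ge0.
Qed.

Lemma avg_abs_le1 f : avg (fun x => f x ^+ 2) <= 1 -> avg (fun x => `|f x|) <= 1.
Proof.
move=> f1; have := avg_cauchy_schwarz (fun x => `|f x|) (fun=> 1).
rewrite (_ : (fun x => `|f x| * 1) = fun x => `|f x|); last first.
  by apply/funext => x; rewrite mulr1.
rewrite (_ : (fun x => `|f x| ^+ 2) = fun x => f x ^+ 2); last first.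
  by apply/funext => x; rewrite real_normK ?num_real.
rewrite expr1n avg_cst mulr1 => /le_trans/(_ f1).
by rewrite expr_le1 ?avg_ge0.
Qed.

End Averages.

(** * Truncation of the Fourier expansion *)

Section Truncation.
Variables (R : realType) (G : finZmodType).
Implicit Types (f : G -> R) (eta : R) (d : dual R G).

Lemma fcoef_dual_opp f d : fcoef f (dual_opp d) = (fcoef f d)^*.
Proof.
rewrite /fcoef [RHS]conjcM; congr (_ * _); last by rewrite conjc_inv conjc_nat.
rewrite [RHS](rmorph_sum (@conjc R)); apply: eq_bigr => x _ /=.
by rewrite conjcM conjc_real chi_dual_opp.
Qed.

(** The real part only serves to land in [R]: the large coefficients of a real function are stable
    under [dual_opp], so the sum is its own conjugate ([truncE]). *)
Definition trunc eta f (x : G) : R :=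
  complex.Re (\sum_(d | eta <= cmod (fcoef f d)) fcoef f d * chi d x).

Lemma truncE eta f x :
  (trunc eta f x)%:C = \sum_(d | eta <= cmod (fcoef f d)) fcoef f d * chi d x.
Proof.
apply: RRe_real; set S := \sum_(d | _) _; apply/complex_realP; exists (complex.Re S).
have SJ : S = S^*.
  rewrite [RHS](rmorph_sum (@conjc R)) /S /= (reindex_inj (@dual_oppI _ _)) /=.
  apply: eq_big => [d|d _]; first by rewrite fcoef_dual_opp cmodJ.
  by rewrite fcoef_dual_opp chi_dual_opp -conjcM.
case: (S) SJ => a b; rewrite /conjc => -[bN] /=.
by apply/eqP; rewrite eq_complex /= eqxx; apply/eqP; lra.
Qed.

Lemma fcoef_trunc eta f d :
  fcoef (trunc eta f) d = if eta <= cmod (fcoef f d) then fcoef f d else 0.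
Proof.
rewrite /fcoef; under eq_bigr do rewrite truncE mulr_suml.
rewrite exchange_big /= -!/(fcoef _ _).
under eq_bigr => d' _.
  under eq_bigr do rewrite -mulrA.
  rewrite -mulr_sumr sum_chi.
  over.
case: ifP => H; last first.
  rewrite big1 ?mul0r // => d' H'; case: eqVneq => [dd|]; last by rewrite !mulr0.
  by rewrite -dd H' in H.
rewrite (bigD1 d) //= big1 ?addr0 ?eqxx => [|d' /andP[_ /negPf->]]; last by rewrite !mulr0.
by rewrite mulr1 mulfK ?cardG_neq0.
Qed.

Lemma energy_trunc eta f : avg (fun x => trunc eta f x ^+ 2) =
  \sum_(d | eta <= cmod (fcoef f d)) cmod (fcoef f d) ^+ 2.
Proof.
rewrite -parseval [RHS]big_mkcond; apply: eq_bigr => d _; rewrite fcoef_trunc.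
by case: ifP => // _; rewrite Normc.normc0 expr0n.
Qed.

Lemma energy_trunc_le eta f : avg (fun x => trunc eta f x ^+ 2) <= avg (fun x => f x ^+ 2).
Proof.
rewrite energy_trunc -parseval big_mkcond; apply: ler_sum => d _.
by case: ifP => // _; rewrite sqr_ge0.
Qed.

(** Pythagoras: the difference of the truncations and the coarser truncation have disjoint
    spectra. *)
Lemma energy_truncB eta1 eta2 f : eta2 <= eta1 ->
  avg (fun x => (trunc eta2 f x - trunc eta1 f x) ^+ 2) =
  avg (fun x => trunc eta2 f x ^+ 2) - avg (fun x => trunc eta1 f x ^+ 2).
Proof.
move=> le21; rewrite -!parseval -sumrB; apply: eq_bigr => d _.
rewrite fcoefB !fcoef_trunc; case: (leP eta1) => [le1|_].
  by rewrite (le_trans le21 le1) subrr !subrr Normc.normc0 expr0n.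
by rewrite subr0 Normc.normc0 expr0n subr0.
Qed.

Lemma energy_sub_trunc eta f :
  avg (fun x => (f x - trunc eta f x) ^+ 2) <= avg (fun x => f x ^+ 2).
Proof.
rewrite -!parseval; apply: ler_sum => d _; rewrite fcoefB fcoef_trunc.
by case: ifP => _; rewrite ?subr0 // subrr Normc.normc0 expr0n sqr_ge0.
Qed.

Lemma fcoef_sub_trunc eta f d : 0 <= eta ->
  cmod (fcoef (fun x => f x - trunc eta f x) d) <= eta.
Proof.
move=> eta0; rewrite fcoefB fcoef_trunc.
case: (leP eta (cmod (fcoef f d))) => [_|/ltW]; last by rewrite subr0.
by rewrite subrr Normc.normc0.
Qed.

(** A retained coefficient has modulus at least [eta], hence at most its square divided by [eta]. *)
Lemma wiener_trunc eta f : 0 < eta ->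
  wiener (trunc eta f) <= avg (fun x => f x ^+ 2) / eta.
Proof.
move=> eta0; rewrite -parseval mulr_suml; apply: ler_sum => d _.
rewrite fcoef_trunc; case: ifP => H; last first.
  by rewrite Normc.normc0 mulr_ge0 ?sqr_ge0 ?invr_ge0 ?ltW.
by rewrite ler_pdivlMr // expr2 ler_wpM2l ?cmod_ge0.
Qed.

End Truncation.

(** * Approximation by polynomials in a function *)

(* The polynomials p_0 = 0, p_{n+1} = p_n + (X^2 - p_n^2) / 2 increase to |X|
   on [-1, 1], uniformly. *)
Lemma wiener_abs_unit (R : realType) (n : nat) : exists2 w : R, 0 <= w &
  forall (G : finZmodType) (k : G -> R), wiener k <= 1 ->
  exists2 b : G -> R, wiener b <= w &
    forall x, [/\ 0 <= b x, b x <= `|k x|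
               & (`|k x| - b x) * (1 + n%:R * `|k x| / 2) <= `|k x|].
Proof.
elim: n => [|n [w w0 IH]].
  exists 0 => // G k k1; exists (fun=> 0); first by rewrite wiener_cst normr0.
  by move=> x; rewrite mul0r mul0r addr0 mulr1 subr0; split.
exists (w + 1 / 2 * (1 + w ^+ 2)) => [|G k k1].
  by have := sqr_ge0 w; lra.
have [b bw bP] := IH G k k1.
exists (fun x => b x + 1 / 2 * (k x * k x + (-1) * (b x * b x))).
  apply: (le_trans (wienerD _ _)); rewrite lerD // wienerZ ger0_norm ?divr_ge0 //.
  rewrite ler_wpM2l ?divr_ge0 //; apply: (le_trans (wienerD _ _)); rewrite lerD //.
    apply: (le_trans (wienerM _ _)); rewrite -(mulr1 1).
    by rewrite ler_pM ?wiener_ge0.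
  rewrite wienerZ normrN1 mul1r; apply: (le_trans (wienerM _ _)); rewrite expr2.
  by rewrite ler_pM ?wiener_ge0.
move=> x; have [b0 bk be] := bP x.
have y1 : `|k x| <= 1 by apply: le_trans k1; exact: sup_le_wiener.
have -> : k x * k x = `|k x| ^+ 2 by rewrite -expr2 real_normK ?num_real.
move: (`|k x|) (normr_ge0 (k x)) bk be y1 => y y0 bk be y1; set c := b x in b0 bk be *.
split; [nra|nra|].
have n0 : 0 <= n%:R * y / 2 :> R by rewrite divr_ge0 ?mulr_ge0.
have e0 : 0 <= y - c by lra.
rewrite -(natr1 n); apply: le_trans be; set m := n%:R * y / 2 in n0 *.
have -> : (n%:R + 1) * y / 2 = m + y / 2 by rewrite /m; ring.
(* One iteration multiplies the error by [1 - (y + c) / 2], at most [1 - y / 2], which absorbs the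
   growth of the other factor from [1 + m] to [1 + m + y / 2]. *)
have -> : y - (c + 1 / 2 * (y ^+ 2 + -1 * (c * c))) = (y - c) * (1 - (y + c) / 2) by field.
rewrite -mulrA ler_wpM2l //; nra.
Qed.

(** After rescaling by [B], the bound of [wiener_abs_unit] makes the error at most [2 / n], so
    [n > 2 * B / tau] suffices. *)
Lemma wiener_abs_approx (R : realType) (B tau : R) : 0 < B -> 0 < tau ->
  exists2 K : R, 0 <= K & forall (G : finZmodType) (k : G -> R), wiener k <= B ->
  exists2 b : G -> R, wiener b <= K & forall x, `| `|k x| - b x| <= tau.
Proof.
move=> B0 tau0; set n := (Num.truncn (2 * B / tau)).+1.
have nP : 2 * B / tau < n%:R by exact: truncnS_gt.
have n0 : 0 < n%:R :> R by rewrite ltr0n.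
have [w w0 wP] := wiener_abs_unit R n; exists (B * w) => [|G k kB].
  by rewrite mulr_ge0 // ltW.
have [|b bw bP] := wP G (fun x => B^-1 * k x).
  by rewrite wienerZ gtr0_norm ?invr_gt0 // mulrC ler_pdivrMr ?mul1r.
exists (fun x => B * b x) => [|x].
  by rewrite wienerZ gtr0_norm // ler_wpM2l // ltW.
have [b0 bk be] := bP x.
have kE : `|k x| = B * `|B^-1 * k x|.
  by rewrite normrM gtr0_norm ?invr_gt0 // mulVKf ?gt_eqF.
rewrite kE -mulrBr normrM gtr0_norm //.
move: (`|_ * k x|) (normr_ge0 (B^-1 * k x)) bk be => y y0 bk be.
rewrite ger0_norm ?subr_ge0 //.
rewrite ltr_pdivrMr // in nP.
have [yz|yz] := eqVneq y 0; first by rewrite yz in bk *; nra.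
have y_gt0 : 0 < y by rewrite lt_def yz.
have : (y - b x) * n%:R <= 2.
  rewrite -(ler_pM2r y_gt0); nra.
move=> en; rewrite -(ler_pM2r n0); nra.
Qed.

Definition neg_part (R : realType) (y : R) : R := Num.max 0 (- y).

Lemma neg_partE (R : realType) (y : R) : neg_part y = 1 / 2 * (`|y| - y).
Proof.
rewrite /neg_part; case: (leP 0 y) => H;
  [rewrite max_l ?ger0_norm|rewrite max_r ?ltr0_norm]; lra.
Qed.

Lemma wiener_neg_part_approx (R : realType) (B tau : R) : 0 < B -> 0 < tau ->
  exists2 K : R, 0 < K & forall (G : finZmodType) (k : G -> R), wiener k <= B ->
  exists2 b : G -> R, wiener b <= K & forall x, `|neg_part (k x) - b x| <= tau.
Proof.
move=> B0 tau0; have [K K0 KP] := wiener_abs_approx B0 tau0.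
exists (1 / 2 * (K + B)) => [|G k kB]; first lra.
have [b bK bP] := KP G k kB; exists (fun x => 1 / 2 * (b x + (-1) * k x)) => [|x].
  rewrite wienerZ ger0_norm ?divr_ge0 // ler_wpM2l ?divr_ge0 //.
  by apply: (le_trans (wienerD _ _)); rewrite lerD // wienerZ normrN1 mul1r.
rewrite neg_partE; have := bP x; rewrite !ler_norml; lra.
Qed.

(** Of two disjoint slices of width [d / 4], one contains at most half of [S]; the induction
    continues inside it, which is why [S] varies. Keeping [t] in the middle half of the slice
    ensures that all smaller neighbourhoods of [t] stay in the slice. *)
Lemma sparse_level (R : realType) (T : finType) (g : T -> R) (J : nat) (S : {set T}) (a d : R) :
  0 < d -> exists t : R, [/\ a + d / 4 <= t, t <= a + d * 3 / 4 &
    forall j, (j <= J)%N ->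
      (#|[set x in S | (`|g x - t| < d / 4 ^+ j.+1)%R]| * 2 ^ j <= #|S|)%N].
Proof.
elim: J S a d => [|J IH] S a d d0.
  exists (a + d / 2); split; [lra|lra|] => j; rewrite leqn0 => /eqP->.
  by rewrite muln1 subset_leq_card //; apply/fintype.subsetP => x; rewrite inE => /andP[].
pose slice b := [set x in S | b <= g x < b + d / 4].
have [b [S2 bl br]] : exists b, [/\ (#|slice b| * 2 <= #|S|)%N, a + d / 4 <= b & b <= a + d / 2].
  set b1 := a + d / 4; set b2 := a + d / 2.
  have disj : (#|slice b1| + #|slice b2| <= #|S|)%N.
    rewrite -cardsUI (_ : finset.setI _ _ = finset.set0) ?cards0 ?addn0.
      by rewrite subset_leq_card // finset.subUset; apply/andP; split;
         apply/fintype.subsetP => x; rewrite inE => /andP[].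
    apply/finset.setP => x; rewrite !inE /b1 /b2; apply/negP; lra.
  case: (leqP #|slice b1| #|slice b2|) => H.
    exists b1; split; [|rewrite /b1 /b2; lra|rewrite /b1 /b2; lra].
    by rewrite muln2 -addnn; apply: leq_trans disj; rewrite leq_add2l.
  exists b2; split; [|rewrite /b1 /b2; lra|rewrite /b1 /b2; lra].
  by rewrite muln2 -addnn; apply: leq_trans disj; rewrite leq_add2r ltnW.
have d4 : 0 < d / 4 by lra.
have [t [t1 t2 tP]] := IH (slice b) b _ d4.
exists t; split; [lra|lra|] => -[_|j jJ].
  by rewrite muln1 subset_leq_card //; apply/fintype.subsetP => x; rewrite inE => /andP[].
rewrite expnS mulnCA mulnC; apply: leq_trans S2; rewrite leq_mul2r /=.
apply: leq_trans (tP j jJ); rewrite leq_mul2r; apply/orP; right.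
apply/subset_leq_card/fintype.subsetP => x; rewrite !inE => /andP[-> Hx] /=.
have E : d / 4 ^+ j.+2 = d / 4 / 4 ^+ j.+1 by rewrite [4 ^+ j.+2]exprS invfM mulrA.
rewrite E in Hx; rewrite Hx andbT.
have : d / 4 / 4 ^+ j.+1 <= d / 4 / 4.
  by rewrite ler_pM2l // lef_pV2 ?posrE ?exprn_gt0 // exprS ler_peMr // exprn_ege1 ?ler1n.
move: Hx; rewrite ltr_norml => /andP[]; lra.
Qed.

(** * Regularity and level sets *)

Lemma avg_mem (R : realType) (G : finZmodType) (S : {set G}) :
  avg (fun x => (x \in S)%:R : R) = #|S|%:R / #|G|%:R.
Proof.
rewrite /avg -sum1_card natr_sum [in RHS]big_mkcond /=; congr (_ / _).
by apply: eq_bigr => x _; case: (x \in S).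
Qed.

Lemma neg_partP (R : realType) (y : R) :
  (0 <= y /\ neg_part y = 0) \/ (y <= 0 /\ neg_part y = - y).
Proof. by rewrite neg_partE; case: (ger0P y) => y0; [left|right]; split; lra. Qed.

(** The increments telescope to at most 1, so one of the [n.+1] is at most their mean bound. *)
Lemma trunc_pigeonhole (R : realType) (G : finZmodType) (f : G -> R) (eta : nat -> R) (n : nat) :
  avg (fun x => f x ^+ 2) <= 1 -> exists2 i, (i < n.+1)%N &
    avg (fun x => trunc (eta i.+1) f x ^+ 2) - avg (fun x => trunc (eta i) f x ^+ 2)
      <= n.+1%:R^-1.
Proof.
move=> f1; set E := fun i => avg (fun x => trunc (eta i) f x ^+ 2).
apply: contrapT => H.
suff : 1 < E n.+1 - E 0.
  apply/negP; rewrite -leNgt; apply: le_trans f1.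
  apply: le_trans (energy_trunc_le (eta n.+1) f).
  by rewrite lerBlDr lerDl avg_ge0 // => x; rewrite sqr_ge0.
have -> : E n.+1 - E 0 = \sum_(i < n.+1) (E i.+1 - E i).
  by rewrite -(telescope_sumr _ (leq0n _)) big_mkord.
have -> : 1 = \sum_(i < n.+1) n.+1%:R^-1 :> R.
  by rewrite sumr_const card_ord -[RHS]mulr_natr mulVf ?pnatr_eq0.
apply: ltr_sum => [|i _]; first by apply/hasP; exists ord0; rewrite ?mem_index_enum.
by rewrite ltNge; apply/negP => le_i; apply: H; exists i.
Qed.

(** With [h] the truncation at the threshold after that of [g], [h - g] is small in L^2 by
    pigeonhole, and [f - h] has coefficients too small to correlate with a polynomial in [g]. *)
Lemma regularity (R : realType) (eta0 kappa : R) : 0 < eta0 -> 0 < kappa ->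
  exists2 L : R, 0 < L & forall (G : finZmodType) (f : G -> R),
    avg (fun x => f x ^+ 2) <= 1 ->
  exists g : G -> R, [/\ wiener g <= L, avg (fun x => g x ^+ 2) <= 1,
      forall d, cmod (fcoef (fun x => f x - g x) d) <= eta0
    & forall a, 0 <= a <= 1 ->
        `|avg (fun x => (f x - g x) * neg_part (g x - a))| <= kappa].
Proof.
move=> eta0_gt0 kappa_gt0.
have kappa4 : 0 < kappa / 4 by lra.
have kappa_ge0 := ltW kappa_gt0.
pose good (B K : R) := 0 < B -> 0 < K /\
  forall (G : finZmodType) (k : G -> R), wiener k <= B ->
  exists2 b : G -> R, wiener b <= K & forall x, `|neg_part (k x) - b x| <= kappa / 4.
have [K KP] : exists K : R -> R, forall B, good B (K B).
  suff /choice[K KP] : forall B, exists K, good B K by exists K.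
  move=> B; have [B0|B0] := ltP 0 B.
    by have [K K0 KP] := wiener_neg_part_approx B0 kappa4; exists K.
  (* For [B <= 0] the property is vacuous and 0 is a dummy value. *)
  by exists 0 => /(le_lt_trans B0); rewrite ltxx.
(* If [g] is truncated at [e], then [1 / e + 1] bounds the Wiener norm of [g - a]; the next
   threshold times the norm of the approximation of [neg_part (g - a)] is thus at most
   [kappa / 4]. *)
pose next (e : R) := Num.min e (kappa / 4 / K (1 / e + 1)).
pose eta i := iter i next eta0.
have eta_gt0 i : 0 < eta i.
  elim: i => //= i IH; rewrite lt_min IH divr_gt0 //.
  by have [] := KP (1 / eta i + 1); rewrite ?addr_gt0 ?divr_gt0.
have eta_dec i j : (i <= j)%N -> eta j <= eta i.
  elim: j => [|j IH]; first by rewrite leqn0 => /eqP->.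
  rewrite leq_eqVlt => /orP[/eqP->//|/IH]; apply: le_trans.
  by rewrite /= ge_min lexx.
pose n := Num.truncn (16 / kappa ^+ 2).
have nP : n.+1%:R^-1 <= (kappa / 4) ^+ 2.
  rewrite -[leRHS]invrK lef_pV2 ?posrE ?ltr0n ?invr_gt0 ?exprn_gt0 //.
  rewrite [leLHS](_ : _ = 16 / kappa ^+ 2); last by field; rewrite gt_eqF.
  exact/ltW/truncnS_gt.
exists (1 / eta n.+1) => [|G f f1]; first by rewrite divr_gt0.
have [i lt_in Ei] := trunc_pigeonhole eta n f1.
set g := trunc (eta i) f; set h := trunc (eta i.+1) f in Ei.
have g1 : avg (fun x => g x ^+ 2) <= 1 by exact: le_trans (energy_trunc_le _ _) f1.
have gL : wiener g <= 1 / eta i.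
  by apply: le_trans (wiener_trunc _ (eta_gt0 i)) _; rewrite ler_pM2r ?invr_gt0.
exists g; split => //.
- by apply: le_trans gL _; rewrite ler_pM2l // lef_pV2 ?posrE // eta_dec // ltnW.
- move=> d; apply: le_trans (eta_dec 0%N i _) => //.
  by apply: fcoef_sub_trunc; exact: ltW.
move=> a /andP[a0 a1]; set psi := fun x => neg_part (g x - a).
have [|K0 /(_ G (fun x => g x + - a)) KG] := KP (1 / eta i + 1).
  by rewrite addr_gt0 ?divr_gt0.
have [|b bK bP] := KG.
  apply: le_trans (wienerD _ _) _; rewrite wiener_cst normrN ger0_norm //.
  exact: lerD.
have -> : avg (fun x => (f x - g x) * psi x) =
    avg (fun x => (h x - g x) * psi x) + avg (fun x => (f x - h x) * psi x).
  by rewrite -avgD; congr avg; apply/funext => x; ring.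
apply: le_trans (ler_normD _ _) _; rewrite [leRHS](_ : _ = kappa / 2 + kappa / 2); last by field.
apply: lerD.
  rewrite -ler_sqr ?nnegrE ?normr_ge0 ?divr_ge0 // real_normK ?num_real //.
  apply: le_trans (avg_cauchy_schwarz _ _) _.
  (* The factor 4 bounds the average of [psi ^+ 2], through [psi ^+ 2 <= 2 * g ^+ 2 + 2]. *)
  rewrite energy_truncB ?eta_dec //; apply: le_trans (_ : (kappa / 4) ^+ 2 * 4 <= _).
    apply: ler_pM => //; rewrite ?avg_ge0 //; last 1 first.
    - apply: le_trans (_ : avg (fun x => 2 * g x ^+ 2 + 2) <= _).
        apply: ler_avg => x; rewrite /psi /neg_part.
        have g2 := sqr_ge0 (g x); have ga2 := sqr_ge0 (g x + a).
        have a2 : a ^+ 2 <= 1 by rewrite expr_le1.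
        case: (leP 0 (- (g x - a))) => _; last lra.
        have -> : (- (g x - a)) ^+ 2 = 2 * g x ^+ 2 + 2 * a ^+ 2 - (g x + a) ^+ 2 by ring.
        lra.
      by rewrite avgD avgZ avg_cst; lra.
    - rewrite subr_ge0 -/g -subr_ge0 -energy_truncB ?eta_dec //.
      by rewrite avg_ge0 // => x; rewrite sqr_ge0.
    - by move=> x; rewrite sqr_ge0.
    - exact: le_trans Ei nP.
  by rewrite le_eqVlt; apply/orP; left; apply/eqP; field.
have -> : avg (fun x => (f x - h x) * psi x) =
    avg (fun x => (f x - h x) * b x) + avg (fun x => (f x - h x) * (psi x - b x)).
  by rewrite -avgD; congr avg; apply/funext => x; ring.
apply: le_trans (ler_normD _ _) _; rewrite [leRHS](_ : _ = kappa / 4 + kappa / 4); last by field.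
apply: lerD.
  apply: le_trans (avg_pairing b (fcoef_sub_trunc f ^~ (ltW (eta_gt0 i.+1)))) _.
  apply: le_trans (_ : eta i.+1 * K (1 / eta i + 1) <= _).
    by rewrite ler_wpM2l // ltW.
  by rewrite -ler_pdivlMr //= ge_min lexx orbT.
apply: le_trans (avg_abs _) _.
apply: le_trans (_ : avg (fun x => kappa / 4 * `|f x - h x|) <= _).
  by apply: ler_avg => x; rewrite normrM mulrC ler_wpM2r //; exact: bP.
rewrite avgZ ler_piMr ?divr_ge0 // avg_abs_le1 //.
exact: le_trans (energy_sub_trunc _ _) f1.
Qed.

(** The function [neg_part (y - r) - neg_part y] is a ramp, equal to [r] for [y <= 0] and to 0 for
    [y >= r]. Comparing with [r + p] instead of [r] prepares a normalisation that is bounded by 1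
    despite the approximation errors. *)
Lemma ramp_approx (R : realType) (r p y u v : R) : 0 < r -> 0 < p ->
  `|neg_part y - u| <= p / 2 -> `|neg_part (y + - r) - v| <= p / 2 ->
  [/\ `|v + (-1) * u| <= r + p, r <= y -> `|v + (-1) * u| <= 2 * p
    & y <= - r -> `|r + p - (v + (-1) * u)| <= 2 * p].
Proof.
move=> r0 p0; rewrite !ler_norml.
have [[? ->]|[? ->]] := neg_partP y; have [[? ->]|[? ->]] := neg_partP (y + - r);
  move=> /andP[? ?] /andP[? ?]; split=> *; rewrite ?ler_norml; lra.
Qed.

Lemma level_set_approx (R : realType) (L d M : R) : 0 < L -> 0 < d -> 0 < M ->
  exists2 K : R, 0 < K & forall (G : finZmodType) (g : G -> R) (t : R),
    wiener g <= L -> `|t| <= 1 ->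
    (forall j, (#|[set x | (`|g x - t| < d / 4 ^+ j.+1)%R]| * 2 ^ j <= #|G|)%N) ->
  exists h : G -> R, [/\ forall x, `|h x| <= 1, wiener h <= K &
    avg (fun x => ((t <= g x)%R%:R - h x) ^+ 2) <= (M ^+ 2)^-1].
Proof.
move=> L0 d0 M0; pose j := (Num.truncn (8 * M ^+ 2)).+1.
have jP : 8 * M ^+ 2 <= 2 ^+ j.
  apply: le_trans (ltW (truncnS_gt _)) _; rewrite -/j -natrX ler_nat.
  by rewrite ltnW // ltn_expl.
set r := d / 4 ^+ j.+1; have r0 : 0 < r by rewrite divr_gt0 ?exprn_gt0.
pose tau := (4 * M)^-1; have tau0 : 0 < tau by rewrite invr_gt0 mulr_gt0.
have tau_ge0 := ltW tau0.
have B0 : 0 < L + (1 + r) by lra.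
have rt : 0 < r * tau / 2 by rewrite divr_gt0 // mulr_gt0.
have [K K0 KP] := wiener_neg_part_approx B0 rt.
set c := (r * (1 + tau))^-1; have c0 : 0 < c by rewrite invr_gt0 mulr_gt0 // addr_gt0.
exists (c * (K + K)) => [|G g t gL t1 sparse].
  by rewrite mulr_gt0 ?addr_gt0.
have [|b1 b1K b1P] := KP G (fun x => (-1) * g x + t).
  apply: le_trans (wienerD _ _) _; rewrite wienerZ normrN1 mul1r wiener_cst.
  by rewrite lerD //; lra.
have [|b2 b2K b2P] := KP G (fun x => (-1) * g x + t + - r).
  rewrite (_ : (fun x => _) = fun x => (-1) * g x + (t - r)); last first.
    by apply/funext => x; rewrite addrA.
  apply: le_trans (wienerD _ _) _; rewrite wienerZ normrN1 mul1r wiener_cst.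
  rewrite lerD //; apply: le_trans (ler_normB _ _) _; rewrite (gtr0_norm r0); lra.
pose h x := c * (b2 x + (-1) * b1 x).
have p0 : 0 < r * tau by rewrite mulr_gt0.
have eP x := @ramp_approx R r (r * tau) ((-1) * g x + t) _ _ r0 p0 (b1P x) (b2P x).
have cE : c * (r * (1 + tau)) = 1 by rewrite mulVf // gt_eqF // mulr_gt0 // addr_gt0.
have c2 : c * (2 * (r * tau)) <= 2 * tau.
  have -> : 2 * tau = c * (r * (1 + tau) * (2 * tau)) by rewrite [RHS]mulrA cE mul1r.
  rewrite ler_pM2l //; have := mulr_gt0 p0 tau0; lra.
exists h; split => [x||].
- have [e1 _ _] := eP x; rewrite /h normrM (gtr0_norm c0) -[leRHS]cE.
  by rewrite ler_pM2l // mulrDr mulr1.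
- rewrite /h wienerZ (gtr0_norm c0) ler_pM2l //; apply: le_trans (wienerD _ _) _.
  by rewrite wienerZ normrN1 mul1r lerD.
pose S := [set x | (`|g x - t| < r)%R].
have HS : avg (fun x => (x \in S)%:R : R) <= (2 ^+ j)^-1.
  rewrite avg_mem ler_pdivrMr ?ltr0n; last by apply/card_gt0P; exists 0.
  by rewrite mulrC ler_pdivlMr ?exprn_gt0 // -natrX -natrM ler_nat sparse.
apply: le_trans (_ : avg (fun x => (2 * tau) ^+ 2 + 4 * (x \in S)%:R) <= _).
  apply: ler_avg => x; have [e1 e2 e3] := eP x.
  rewrite inE; case: ltP => H.
    rewrite mulr1; apply: le_trans (_ : 2 ^+ 2 <= _); last by have := sqr_ge0 (2 * tau); lra.
    rewrite -[leLHS]real_normK ?num_real // lerXn2r ?nnegrE //.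
    apply: le_trans (ler_normB _ _) _; rewrite -[2]/(1 + 1) lerD //.
      by case: (t <= g x); rewrite ?normr1 ?normr0.
    by rewrite /h normrM (gtr0_norm c0) -[leRHS]cE ler_pM2l // mulrDr mulr1.
  rewrite mulr0 addr0 -[leLHS]real_normK ?num_real // lerXn2r ?nnegrE ?mulr_ge0 //.
  apply: le_trans c2; rewrite /h.
  move: H; rewrite ler_normr => /orP[H|H].
    have -> : t <= g x by lra.
    rewrite [X in X - _](esym cE) -mulrBr normrM (gtr0_norm c0) ler_pM2l //.
    by rewrite mulrDr mulr1 e3 //; lra.
  have -> : (t <= g x) = false by apply/negbTE; rewrite -ltNge; lra.
  by rewrite sub0r normrN normrM (gtr0_norm c0) ler_pM2l // e2 //; lra.
rewrite avgD avg_cst avgZ; apply: le_trans (_ : (2 * tau) ^+ 2 + 4 * (8 * M ^+ 2)^-1 <= _).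
  rewrite lerD2l ler_pM2l //; apply: le_trans HS _.
  by rewrite lef_pV2 ?posrE ?exprn_gt0 // mulr_gt0 ?exprn_gt0.
have := invr_gt0 (M ^+ 2); rewrite exprn_gt0 // => M2.
have -> : (2 * tau) ^+ 2 = (M ^+ 2)^-1 / 4 by rewrite /tau; field; rewrite gt_eqF.
have -> : 4 * (8 * M ^+ 2)^-1 = (M ^+ 2)^-1 / 2 by field; rewrite gt_eqF.
lra.
Qed.

Lemma level_set_measurable (R : realType) (L d : R) : 0 < L -> 0 < d ->
  exists2 F : R -> R, growth_function F & forall (G : finZmodType) (g : G -> R) (t : R),
    wiener g <= L -> `|t| <= 1 ->
    (forall j, (#|[set x | (`|g x - t| < d / 4 ^+ j.+1)%R]| * 2 ^ j <= #|G|)%N) ->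
  set_measurable1 F [set x | t <= g x].
Proof.
move=> L0 d0.
pose good (m : nat) (K : R) := 0 < K /\ forall (G : finZmodType) (g : G -> R) (t : R),
    wiener g <= L -> `|t| <= 1 ->
    (forall j, (#|[set x | (`|g x - t| < d / 4 ^+ j.+1)%R]| * 2 ^ j <= #|G|)%N) ->
  exists h : G -> R, [/\ forall x, `|h x| <= 1, wiener h <= K &
    avg (fun x => ((t <= g x)%R%:R - h x) ^+ 2) <= (m.+1%:R ^+ 2)^-1].
have [K KP] : exists K : nat -> R, forall m, good m (K m).
  suff /choice[K KP] : forall m, exists K, good m K by exists K.
  move=> m.
  by have [|K K0 KP] := @level_set_approx R L d m.+1%:R L0 d0; [rewrite ltr0n|exists K].
have K0 m : 0 < K m by have [] := KP m.
(* Summing the bounds for integer precisions gives a monotone function; its last term, for precision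
   [(Num.truncn M).+1 > M], is the one that serves [M]. *)
exists (fun M => \sum_(m < (Num.truncn M).+1) K m).
  split => [M _|M N M0 MN].
    by rewrite big_ord_recr ltr_wpDl //= sumr_ge0 // => i _; exact: ltW.
  rewrite -!(big_mkord xpredT K).
  rewrite (big_cat_nat (n := (Num.truncn M).+1) (p := (Num.truncn N).+1)) //=; last first.
    by rewrite ltnS le_truncn.
  by rewrite lerDl sumr_ge0 // => i _; exact: ltW.
move=> G g t gL t1 sparse; split=> [x|M M0].
  by rewrite /indicator; case: (x \in _); rewrite ?Normc.normc1 ?Normc.normc0.
have [_ /(_ G g t gL t1 sparse)[h [h1 hK hM]]] := KP (Num.truncn M).
exists (fun x => (h x)%:C); split => [x||].
- by rewrite cmod_real.
- rewrite wienerE; apply: le_trans hK _; rewrite big_ord_recr lerDr sumr_ge0 // => i _.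
  exact: ltW.
rewrite /norm2 [X in Num.sqrt (X / _)](_ : _ = \sum_x ((t <= g x)%R%:R - h x) ^+ 2).
  apply: le_trans (_ : Num.sqrt ((M ^+ 2)^-1) <= _).
    apply: ler_wsqrtr; apply: le_trans hM _.
    rewrite lef_pV2 ?posrE ?exprn_gt0 ?ltr0n // lerXn2r ?nnegrE ?(ltW M0) //.
    exact/ltW/truncnS_gt.
  by rewrite -exprVn sqrtr_sqr gtr0_norm ?invr_gt0.
apply: eq_bigr => x _; rewrite /indicator inE -(rmorph_nat (real_complex R)) -rmorphB.
by rewrite cmod_real real_normK ?num_real.
Qed.

(** Level [j = #|G|] already forces an empty neighbourhood, since [#|G| < 2 ^ #|G|]; smaller radii
    then cost nothing. *)
Lemma sparse_level_all (R : realType) (G : finZmodType) (g : G -> R) (a d : R) : 0 < d ->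
  exists t : R, [/\ a + d / 4 <= t, t <= a + d * 3 / 4 & forall j,
      (#|[set x | (`|g x - t| < d / 4 ^+ j.+1)%R]| * 2 ^ j <= #|G|)%N].
Proof.
move=> d0; have [t [t1 t2 tP]] := @sparse_level R G g #|G| [set: G]%SET a d d0.
exists t; split => // j.
have E k : [set x in [set: G]%SET | (`|g x - t| < d / 4 ^+ k.+1)%R] =
    [set x | (`|g x - t| < d / 4 ^+ k.+1)%R] by apply/finset.setP => x; rewrite !inE.
case: (leqP j #|G|) => [/tP|jG]; first by rewrite E cardsT.
suff -> : #|[set x | (`|g x - t| < d / 4 ^+ j.+1)%R]| = 0%N by [].
apply/eqP; rewrite -leqn0.
apply: (@leq_trans #|[set x | (`|g x - t| < d / 4 ^+ #|G|.+1)%R]|).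
  apply/subset_leq_card/fintype.subsetP => x; rewrite !inE => /lt_le_trans; apply.
  rewrite ler_pM2l // lef_pV2 ?posrE ?exprn_gt0 // ler_weXn2l ?ler1n //.
  by rewrite ltnS ltnW.
have := tP _ (leqnn _); rewrite E cardsT leqNgt => H.
rewrite leqNgt; apply: contra H => c0; apply: leq_trans (ltn_expl #|G| (ltnSn 1)) _.
by rewrite leq_pmull.
Qed.

(** * Convolution and popular sums *)

Section Convolution.
Variables (R : realType) (G : finZmodType).
Implicit Types (u v f g : G -> R).

Lemma convC u v x : conv u v x = conv v u x.
Proof.
rewrite /conv /avg (reindex_inj (inj_comp (addrI x) (@oppr_inj _))) /=.
by congr (_ / _); apply: eq_bigr => y _; rewrite subKr mulrC.
Qed.

Lemma convDl u1 u2 v x : conv (fun y => u1 y + u2 y) v x = conv u1 v x + conv u2 v x.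
Proof. by rewrite /conv -avgD; congr avg; apply/funext => y; rewrite mulrDl. Qed.

Lemma convBl u1 u2 v x : conv (fun y => u1 y - u2 y) v x = conv u1 v x - conv u2 v x.
Proof.
apply/eqP; rewrite eq_sym subr_eq -convDl; apply/eqP.
by congr conv; apply/funext => y; rewrite subrK.
Qed.

Lemma convDr u v1 v2 x : conv u (fun y => v1 y + v2 y) x = conv u v1 x + conv u v2 x.
Proof. by rewrite convC convDl !(convC u). Qed.

Lemma conv_sqr_le u v x :
  conv u v x ^+ 2 <= avg (fun y => u y ^+ 2) * avg (fun y => v y ^+ 2).
Proof.
apply: le_trans (avg_cauchy_schwarz _ _) _.
rewrite [X in _ * X <= _](_ : _ = avg (fun y => v y ^+ 2)) //.
rewrite /avg [in RHS](reindex_inj (inj_comp (addrI x) (@oppr_inj _))).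
by congr (_ / _); apply: eq_bigr.
Qed.

Lemma conv_mem (A B : {set G}) x :
  conv (fun y => (y \in A)%:R) (fun y => (y \in B)%:R) x =
    #|A :&: [set x - b | b in B]|%:R / #|G|%:R :> R.
Proof.
rewrite -avg_mem /conv; congr avg; apply/funext => y.
rewrite -natrM mulnb finset.in_setI; congr (_ && _)%:R.
apply/idP/imsetP => [xyB|[b bB ->]]; last by rewrite subKr.
by exists (x - y) => //; rewrite subKr.
Qed.

End Convolution.

Lemma ler_of_sqr (R : realDomainType) (x s : R) : 0 <= s -> x ^+ 2 <= s ^+ 2 -> x <= s.
Proof.
move=> s0 H; apply: le_trans (ler_norm x) _.
by rewrite -ler_sqr ?nnegrE // real_normK ?num_real.
Qed.

Section LevelSet.
Variables (R : realType) (G : finZmodType).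
Implicit Types (f g : G -> R) (A : {set G}).

(** Where [g < 0], the product [(f - g) * (- g)] is at least [g ^+ 2] because [f >= 0]. *)
Lemma neg_part_energy_le f g (kappa : R) : (forall x, 0 <= f x) ->
  `|avg (fun x => (f x - g x) * neg_part (g x - 0))| <= kappa ->
  avg (fun x => neg_part (g x) ^+ 2) <= kappa.
Proof.
move=> f0; apply: le_trans; apply: le_trans (ler_norm _); apply: ler_avg => x.
rewrite subr0; have := f0 x; move: (f x) (g x) => u v u0.
case: (neg_partP v) => -[v0 ->]; first by rewrite expr0n mulr0.
by rewrite -oppr_ge0 in v0; have := mulr_ge0 u0 v0; lra.
Qed.

(** The averaged product is at least [- eps ^+ 2 / 4] everywhere, since [y ^+ 2 - eps * y] is, and
    it gains [eps - y >= eps / 2] at the points of [A] where [y = g x < t]. *)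
Lemma level_set_misses A g (eps kappa t : R) : 0 < eps -> t <= eps / 2 ->
  `|avg (fun x => ((x \in A)%:R - g x) * neg_part (g x - eps))| <= kappa ->
  kappa <= eps ^+ 2 / 4 ->
  #|A :\: [set x | t <= g x]|%:R / #|G|%:R <= eps.
Proof.
move=> eps0 t2 orth k4; rewrite -avg_mem.
set S := _ :\: _; set c := avg _ in orth.
have {}orth : c <= kappa := le_trans (ler_norm c) orth.
suff : eps / 2 * avg (fun x => (x \in S)%:R : R) <= eps ^+ 2 / 2.
  have -> : eps ^+ 2 / 2 = eps / 2 * eps by field.
  by rewrite ler_pM2l // divr_gt0.
apply: le_trans (_ : avg (fun x => ((x \in A)%:R - g x) * neg_part (g x - eps) + eps ^+ 2 / 4) <= _).
  rewrite -avgZ; apply: ler_avg => x; rewrite !inE -ltNge.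
  move: (g x) => y {S c orth k4}.
  have q := sqr_ge0 (y - eps / 2).
  case: (neg_partP (y - eps)) => -[ge ->].
    have -> : (y < t) = false by lra.
    by rewrite /= mulr0 mulr0 add0r divr_ge0 ?sqr_ge0.
  by case: (x \in A); case: (ltP y t) => yt /=; lra.
by rewrite avgD avg_cst -/c; lra.
Qed.

(* Each of the terms of conv g_+ g_+ - conv g g contains the negative part of g. *)
Lemma popular_sums_conv_ge g (eps s t : R) x :
  0 < eps -> eps / 4 <= t -> 0 < s -> s <= 1 -> s = (eps / 4) ^+ 2 * eps ->
  avg (fun y => g y ^+ 2) <= 1 -> avg (fun y => neg_part (g y) ^+ 2) <= (s / 8) ^+ 2 ->
  x \in popular_sums eps [set y | t <= g y] -> s / 2 <= conv g g x.
Proof.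
move=> eps0 t1 s0 s1 sE g1 n_le; set A' := [set y | _]; rewrite inE => pop.
have {}pop : eps <= conv (fun y => (y \in A')%:R) (fun y => (y \in A')%:R) x.
  by rewrite conv_mem ler_pdivlMr // ltr0n; apply/card_gt0P; exists 0.
pose n y := neg_part (g y); pose p y := g y + n y.
have pA z : 0 <= p z /\ eps / 4 * (z \in A')%:R <= p z.
  rewrite inE /p /n; move: (g z) => y.
  have y_lt : y < t -> (t <= y) = false by rewrite ltNge => /negbTE.
  have e4 : 0 < eps / 4 by rewrite divr_gt0.
  case: (neg_partP y) => -[y0 ->].
    rewrite addr0; split=> //; case: (leP t y) => ty; rewrite ?mulr1 ?mulr0 //.
    exact: le_trans ty.
  by rewrite subrr y_lt ?mulr0 //; apply: le_lt_trans y0 (lt_le_trans e4 t1).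
have pp : s <= conv p p x.
  apply: le_trans (_ : (eps / 4) ^+ 2 * conv (fun y => (y \in A')%:R)
      (fun y => (y \in A')%:R) x <= _).
    by rewrite sE ler_pM2l // exprn_gt0 // divr_gt0.
  have e4 : 0 <= eps / 4 by rewrite divr_ge0 // ltW.
  rewrite -avgZ; apply: ler_avg => y; have [_ ?] := pA y; have [_ ?] := pA (x - y).
  by rewrite expr2 mulrACA; apply: ler_pM; rewrite // mulr_ge0.
have s8 : 0 <= s / 8 by rewrite divr_ge0 // ltW.
have ng v : avg (fun x => v x ^+ 2) <= 1 -> conv n v x <= s / 8.
  move=> v1; apply: ler_of_sqr => //.
  apply: le_trans (conv_sqr_le _ _ _) _; rewrite -[leRHS]mulr1.
  by rewrite ler_pM ?avg_ge0 // => y; exact: sqr_ge0.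
have n1 : avg (fun y => n y ^+ 2) <= 1.
  by apply: le_trans n_le _; rewrite expr_le1 // ler_pdivrMr // mul1r (le_trans s1) // ler1n.
(* Expanding [conv p p] leaves two cross terms and [conv n n], together at most [3 * s / 8]. *)
have := ng g g1; have := ng n n1; move: s0 pp.
by rewrite {1 2}/p !convDl !convDr (convC g n); clear; lra.
Qed.

End LevelSet.

(** * Choice of the constants and conclusion *)

Theorem proposition2p5 (R : realType) (eps : R)
    (eps_gt0 : 0 < eps) (eps_lt : eps < 1 / 2) :
  exists F : R -> R, growth_function F /\
    forall (G : finZmodType) (A : {set G}),
      exists A' : {set G},
        [/\ set_measurable1 F A',
            #|A :\: A'|%:R <= eps * #|G|%:R
          & #|popular_sums eps A' :\: sumset A A|%:R <= eps * #|G|%:R].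
Proof.
pose s := (eps / 4) ^+ 2 * eps.
have s0 : 0 < s by rewrite mulr_gt0 // exprn_gt0 // divr_gt0.
have s1 : s <= eps / 64.
  have e2 : eps ^+ 2 <= 1 / 4 by nra.
  by have := ler_wpM2l (ltW eps_gt0) e2; rewrite /s; lra.
(* This is the bound on the negative part of [g] required by [popular_sums_conv_ge]; being at most
   [eps ^+ 2 / 4], it also suits [level_set_misses]. *)
pose kappa := (s / 8) ^+ 2; have kappa0 : 0 < kappa by rewrite exprn_gt0 // divr_gt0.
have k4 : kappa <= eps ^+ 2 / 4.
  apply: le_trans (_ : (eps / 512) ^+ 2 <= _); last by have := sqr_ge0 eps; lra.
  by rewrite lerXn2r ?nnegrE; lra.
(* Chosen so that [eta0 ^+ 2 * 4 = (s / 2) ^+ 2 * eps ^+ 2] in the final Chebyshev bound. *)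
pose eta0 := eps * s / 4; have eta00 : 0 < eta0 by rewrite divr_gt0 // mulr_gt0.
have [L L0 reg] := regularity eta00 kappa0.
have d0 : 0 < eps / 4 by lra.
have [F Fg FP] := level_set_measurable L0 d0.
exists F; split=> // G A.
have N0 : 0 < #|G|%:R :> R by rewrite ltr0n; apply/card_gt0P; exists 0.
pose f (x : G) : R := (x \in A)%:R.
have f1 : avg (fun x => f x ^+ 2) <= 1.
  rewrite -[leRHS](avg_cst G) ler_avg // => x.
  by rewrite /f; case: (x \in A); rewrite ?expr0n ?expr1n.
have [g [gL g1 ueta orth]] := reg G f f1.
have [t [t1 t2 sparse]] := sparse_level_all g (eps / 4) d0.
pose A' : {set G} := [set x | t <= g x]; exists A'.
have n_le : avg (fun x => neg_part (g x) ^+ 2) <= kappa.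
  by apply: (@neg_part_energy_le _ _ f) => [x|]; [rewrite ler0n|apply: orth; rewrite lexx ler01].
split.
- by apply: FP => //; rewrite ler_norml; lra.
- rewrite -ler_pdivrMr //; apply: level_set_misses k4 => //; first lra.
  by apply: orth; lra.
(* Convolution being commutative, f * f - g * g factors as (f - g) * (f + g). *)
pose w x := f x + g x.
have w_le : avg (fun x => w x ^+ 2) <= 4.
  apply: le_trans (_ : avg (fun x => 2 * f x ^+ 2 + 2 * g x ^+ 2) <= _).
    apply: ler_avg => x; rewrite /w; move: (f x) (g x) => u v.
    by have := sqr_ge0 (u - v); clear; lra.
  by rewrite avgD !avgZ; move: f1 g1; clear; lra.
have convw x : conv (fun y => f y - g y) w x = conv f f x - conv g g x.
  by rewrite convBl !convDr (convC g f); ring.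
pose D := popular_sums eps A' :\: sumset A A.
have on_D x : x \in D -> s / 2 <= - conv (fun y => f y - g y) w x.
  rewrite 1!inE convw => /andP[xAA pop].
  have -> : conv f f x = 0.
    rewrite /conv /f /avg big1 ?mul0r // => y _.
    rewrite -natrM mulnb; case: andP => // -[yA xyA]; case/negP: xAA.
    by apply/imset2P; exists y (x - y) => //; rewrite addrC subrK.
  rewrite sub0r opprK; apply: popular_sums_conv_ge pop => //; lra.
rewrite -/D -ler_pdivrMr // -avg_mem.
have s2 : 0 < s / 2 by rewrite divr_gt0.
(* Chebyshev's inequality in L^2 on [D], where the convolution of [f - g] with [w] is at most
   [- s / 2]. *)
have : (s / 2) ^+ 2 * avg (fun x => (x \in D)%:R : R) <= eta0 ^+ 2 * 4.
  rewrite -avgZ; apply: le_trans (_ : avg (fun x => conv (fun y => f y - g y) w x ^+ 2) <= _).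
    apply: ler_avg => x; case: (boolP (x \in D)) => [/on_D H|_].
      by rewrite mulr1 -[leRHS]sqrrN lerXn2r ?nnegrE ?(ltW s2) // (le_trans (ltW s2) H).
    by rewrite mulr0 sqr_ge0.
  by apply: le_trans (avg_conv_sqr w ueta) _; rewrite ler_pM2l // exprn_gt0.
have -> : eta0 ^+ 2 * 4 = (s / 2) ^+ 2 * (eps ^+ 2) by rewrite /eta0; field.
rewrite ler_pM2l ?exprn_gt0 // => /le_trans; apply.
by rewrite expr2 ler_piMr ?ltW // (lt_trans eps_lt) // ltr_pdivrMr // mul1r ltr1n.
Qed.
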